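(* Let $p, q$ be real numbers with $1\le p\le q<\infty$. Then (i) $\ell^p_q\subset\ell^\infty$, and (ii) $\ell^p_\infty=\ell^\infty$ (equality as sets of sequences). Moreover, the inclusion $\ell^p_q\subset\ell^\infty$ is proper, i.e. $\ell^\infty\setminus\ell^p_q\neq\emptyset$.
   Context: For $m\in\mathbb{Z}$ and $N\in\mathbb{N}_0=\mathbb{N}\cup\{0\}$ let $S_{m,N}:=\{m-N,\ldots,m,\ldots,m+N\}\subset\mathbb{Z}$, so $|S_{m,N}|=2N+1$. For $1\le p\le q<\infty$, the discrete Morrey space $\ell^p_q=\ell^p_q(\mathbb{Z})$ is the set of all scalar sequences $x=(x_j)_{j\in\mathbb{Z}}$ such that $$\|x\|_{\ell^p_q}:=\sup_{m\in\mathbb{Z},\,N\in\mathbb{N}_0}|S_{m,N}|^{\frac1q-\frac1p}\Big(\sum_{j\in S_{m,N}}|x_j|^p\Big)^{\frac1p}<\infty.$$ For $1\le p<\infty$, $\ell^p_\infty$ is the set of all scalar sequences $x=(x_j)_{j\in\mathbb{Z}}$ such that $$\|x\|_{\ell^p_\infty}:=\sup_{m\in\mathbb{Z},\,N\in\mathbb{N}_0}|S_{m,N}|^{-\frac1p}\Big(\sum_{j\in S_{m,N}}|x_j|^p\Big)^{\frac1p}<\infty.$$ $\ell^\infty=\ell^\infty(\mathbb{Z})$ is the set of all scalar sequences $x=(x_j)_{j\in\mathbb{Z}}$ with $\|x\|_{\ell^\infty}:=\sup_{j\in\mathbb{Z}}|x_j|<\infty$. *)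

(* Defs.v *)
From HB Require Import structures.
From mathcomp Require Import all_boot all_order all_algebra.
From mathcomp Require Import complex.
From mathcomp Require Import all_classical all_reals all_analysis.
From mathcomp Require Import zify.

Set Implicit Arguments.
Unset Strict Implicit.
Unset Printing Implicit Defensive.

Import Order.TTheory GRing.Theory Num.Theory.

Local Open Scope classical_set_scope.
Local Open Scope ring_scope.

Definition window (m : int) (N : nat) : seq int :=
  [seq m - N%:Z + k%:Z | k <- iota 0 N.*2.+1].

Lemma size_window (m : int) (N : nat) : size (window m N) = N.*2.+1.
Proof. by rewrite size_map size_iota. Qed.

Lemma uniq_window (m : int) (N : nat) : uniq (window m N).
Proof. by rewrite map_inj_uniq ?iota_uniq// => i j; lia. Qed.

Lemma mem_window (m : int) (N : nat) (j : int) :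
  (j \in window m N) = (m - N%:Z <= j <= m + N%:Z).
Proof.
apply/mapP/idP => [[k]|jmN]; first by rewrite mem_iota; lia.
by exists (absz (j - (m - N%:Z))%R); rewrite ?mem_iota; lia.
Qed.

Section morrey.
(* [K] is the scalar field; only its [R]-valued absolute value is used, so that
   the reals and the complex numbers are both covered. *)
Context {R : realType} {K : normedZmodType R}.
Implicit Types (p q : R) (x : int -> K).

Definition window_lpnorm p x (m : int) (N : nat) : R :=
  (\sum_(j <- window m N) `|x j| `^ p) `^ p^-1.

(* The norms take values in the extended reals: a supremum may be infinite. *)
Definition morrey_norm p q x : \bar R :=
  ereal_sup [set ((size (window mN.1 mN.2))%:R `^ (q^-1 - p^-1)
                  * window_lpnorm p x mN.1 mN.2)%:E | mN in [set: int * nat]].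

Definition morreyoo_norm p x : \bar R :=
  ereal_sup [set ((size (window mN.1 mN.2))%:R `^ (- p^-1)
                  * window_lpnorm p x mN.1 mN.2)%:E | mN in [set: int * nat]].

Definition linfty_norm x : \bar R := ereal_sup [set `|x j|%:E | j in [set: int]].

End morrey.

Definition morrey (R : realType) (K : normedZmodType R) (p q : R) :
    set (int -> K) := [set x | (morrey_norm p q x < +oo)%E].

Definition morreyoo (R : realType) (K : normedZmodType R) (p : R) :
    set (int -> K) := [set x | (morreyoo_norm p x < +oo)%E].

Definition linfty (R : realType) (K : normedZmodType R) : set (int -> K) :=
  [set x | (linfty_norm x < +oo)%E].

Arguments morrey : clear implicits.
Arguments morreyoo : clear implicits.
Arguments linfty : clear implicits.

(* Main.v *)
Require Import Defs.
From mathcomp Require Import all_boot all_order all_algebra.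
From mathcomp Require Import complex.
From mathcomp Require Import all_classical all_reals all_analysis.

Set Implicit Arguments.
Unset Strict Implicit.
Unset Printing Implicit Defensive.

Import Order.TTheory GRing.Theory Num.Theory.

Local Open Scope classical_set_scope.
Local Open Scope ring_scope.

(** A window with [N = 0] is one point of weight 1, so every [|x j|] is among the quantities under
    each Morrey supremum; hence both inclusions into l^oo ([bounded_of_window_bounded]). Conversely,
    a bound C on all [|x j|] bounds the p-norm over a window S by |S|^(1/p) C, and the weight
    |S|^(-1/p) cancels the growth exactly ([window_lpnorm_le]). For finite q the weight leaves a
    factor |S|^(1/q), so a nonzero constant sequence is bounded but not Morrey
    ([cst_notin_morrey]). *)

Lemma ereal_sup_EFin_lty (R : realType) (I : Type) (f : I -> R) :
  (ereal_sup [set (f i)%:E | i in [set: I]] < +oo)%E <->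
  exists M, forall i, f i <= M.
Proof.
split=> [|[M fM]]; last first.
  apply: (@le_lt_trans _ _ M%:E); last exact: ltry.
  by apply: ge_ereal_sup => _ [i _ <-]; rewrite lee_fin.
have fsup i : ((f i)%:E <= ereal_sup [set (f i)%:E | i in [set: I]])%E.
  by apply: ereal_sup_ubound; exists i.
move: fsup; case: (ereal_sup _) => [r|//|] fsup _.
  by exists r => i; rewrite -lee_fin.
(* A supremum equal to -oo forces [I] to be empty, so any bound will do. *)
by exists 0 => i; have := fsup i; rewrite leeNy_eq.
Qed.

Section morrey_linfty.
Context {R : realType} {K : normedZmodType R}.
Implicit Types (p q a C : R) (x : int -> K).

Lemma window_lpnorm0 p x (m : int) : p != 0 -> window_lpnorm p x m 0 = `|x m|.
Proof.
move=> p0; rewrite /window_lpnorm /window /= big_seq1 subr0 addr0.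
by rewrite -powRrM mulfV// powRr1.
Qed.

Lemma size_window_gt0 (m : int) N : 0 < (size (window m N))%:R :> R.
Proof. by rewrite size_window. Qed.

Lemma window_lpnorm_le p x C m N : 0 < p -> (forall j, `|x j| <= C) ->
  window_lpnorm p x m N <= (size (window m N))%:R `^ p^-1 * C.
Proof.
move=> p0 xC; have C0 : 0 <= C by apply: le_trans (xC 0).
(* Writing C as (C^p)^(1/p) puts both sides under the same increasing power 1/p; it remains to
   compare the sum with |S| copies of C^p. *)
have -> : (size (window m N))%:R `^ p^-1 * C =
          ((size (window m N))%:R * C `^ p) `^ p^-1.
  by rewrite powRM ?powR_ge0 ?ler0n// -powRrM mulfV ?gt_eqF// powRr1.
apply: ge0_ler_powR; rewrite ?nnegrE ?invr_ge0 ?(ltW p0)//.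
- by apply: sumr_ge0 => j _; exact: powR_ge0.
- by rewrite mulr_ge0 ?powR_ge0.
rewrite -sum1_size natr_sum mulr_suml; apply: ler_sum => j _.
by rewrite mul1r ge0_ler_powR ?nnegrE ?(ltW p0).
Qed.

Lemma window_lpnorm_cst p (c : K) m N : p != 0 ->
  window_lpnorm p (fun=> c) m N = (size (window m N))%:R `^ p^-1 * `|c|.
Proof.
move=> p0; rewrite /window_lpnorm big_const_seq count_predT iter_addr_0.
by rewrite -[_ `^ p *+ _]mulr_natl powRM ?powR_ge0// -powRrM mulfV// powRr1.
Qed.

(* A window with [N = 0] is a single point, of weight 1. *)
Lemma bounded_of_window_bounded p a x C : p != 0 ->
  (forall mN : int * nat, (size (window mN.1 mN.2))%:R `^ a
     * window_lpnorm p x mN.1 mN.2 <= C) ->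
  forall j, `|x j| <= C.
Proof.
move=> p0 xC j; have := xC (j, 0).
by rewrite /= window_lpnorm0// powR1 mul1r.
Qed.

Lemma morrey_sub_linfty p q : p != 0 -> morrey R K p q `<=` linfty R K.
Proof.
move=> p0 x /ereal_sup_EFin_lty[C xC]; apply/ereal_sup_EFin_lty.
by exists C; exact: bounded_of_window_bounded xC.
Qed.

Lemma morreyoo_eq_linfty p : 0 < p -> morreyoo R K p = linfty R K.
Proof.
move=> p0; apply/seteqP; split=> x /ereal_sup_EFin_lty[C xC];
    apply/ereal_sup_EFin_lty; exists C.
  by apply: bounded_of_window_bounded xC; rewrite gt_eqF.
move=> [m N] /=; rewrite powRN ler_pdivrMl ?powR_gt0 ?size_window_gt0//.
exact: window_lpnorm_le.
Qed.

Lemma cst_linfty (c : K) : linfty R K (fun=> c).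
Proof. by apply/ereal_sup_EFin_lty; exists `|c|. Qed.

(* The weighted window norms are [(2N+1)^(1/q) * `|c|], unbounded in [N]. *)
Lemma cst_notin_morrey p q (c : K) : p != 0 -> 0 < q -> c != 0 ->
  ~ morrey R K p q (fun=> c).
Proof.
move=> p0 q0 c0 /ereal_sup_EFin_lty[M cM].
have c_gt0 : 0 < `|c| by rewrite normr_gt0.
have sizeM N : (N.*2.+1)%:R <= (M / `|c|) `^ q :> R.
  have := cM (0, N); rewrite window_lpnorm_cst// size_window mulrA.
  rewrite -powRD ?pnatr_eq0 ?implybT// subrK -ler_pdivlMr// => le_M.
  have -> : (N.*2.+1)%:R = ((N.*2.+1)%:R `^ q^-1) `^ q :> R.
    by rewrite -powRrM mulVf ?gt_eqF// powRr1.
  (* The sign of [M] is not given: M/|c| is nonnegative because it dominates this power, so both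
     sides can be raised to the power q. *)
  have pow0 : 0 <= (N.*2.+1)%:R `^ q^-1 :> R by exact: powR_ge0.
  by rewrite ge0_ler_powR ?nnegrE ?(ltW q0)// (le_trans pow0).
(* The Archimedean property gives N > (M/|c|)^q, while [sizeM] gives N <= 2N+1 <= (M/|c|)^q. *)
have := archi_boundP (powR_ge0 (M / `|c|) q).
set N := Num.bound _; apply/negP; rewrite -leNgt.
by apply: le_trans (sizeM N); rewrite ler_nat -addnn -addnS leq_addr.
Qed.

Lemma linfty_setD_morrey_neq0 p q (c : K) : p != 0 -> 0 < q -> c != 0 ->
  linfty R K `\` morrey R K p q !=set0.
Proof.
by move=> p0 q0 c0; exists (fun=> c); split;
  [exact: cst_linfty | exact: cst_notin_morrey].
Qed.

End morrey_linfty.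

(* The first conjunct is about real sequences, the second about complex ones:
   [Rcomplex R] is [R[i]] with its modulus taken as an element of [R]. *)
Theorem theorem2p4 (R : realType) (p q : R) (p_ge1 : 1 <= p) (le_pq : p <= q) :
  [/\ morrey R R p q `<=` linfty R R,
      morreyoo R R p = linfty R R
    & linfty R R `\` morrey R R p q !=set0]
  /\
  [/\ morrey R (Rcomplex R) p q `<=` linfty R (Rcomplex R),
      morreyoo R (Rcomplex R) p = linfty R (Rcomplex R)
    & linfty R (Rcomplex R) `\` morrey R (Rcomplex R) p q !=set0].
Proof.
have p0 : 0 < p by apply: lt_le_trans p_ge1.
have q0 : 0 < q by apply: lt_le_trans le_pq.
have pn0 : p != 0 by rewrite gt_eqF.
split; split; [exact: morrey_sub_linfty | exact: morreyoo_eq_linfty | |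
  exact: morrey_sub_linfty | exact: morreyoo_eq_linfty | ].
- exact: (@linfty_setD_morrey_neq0 _ _ _ _ 1) (oner_neq0 R).
- exact: (@linfty_setD_morrey_neq0 _ (Rcomplex R) _ _ 1) (oner_neq0 _).
Qed.
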